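(* Let $\hat f(a)=\sum_{j=1}^K\hat\varphi_j(a_j)$ with functions $\hat\varphi_j:\mathcal A_j\to\mathbb R$, and let $\hat A_k^{\mathrm{LS}}(a_{\le k})=\mathbb E_\pi[\hat f(a)\mid a_{\le k}]-\mathbb E_\pi[\hat f(a)\mid a_{<k}]$. Then for every $k\in\{1,\dots,K\}$ and every $a_{\le k}$, $$\hat A_k^{\mathrm{LS}}(a_{\le k})=\Bigl(\hat\varphi_k(a_k)-\mathbb E_{a_k'\sim\pi_k(\cdot\mid a_{<k})}[\hat\varphi_k(a_k')]\Bigr)+\sum_{j>k}\Bigl(\mathbb E_{\pi}[\hat\varphi_j(a_j)\mid a_{\le k}]-\mathbb E_{\pi}[\hat\varphi_j(a_j)\mid a_{<k}]\Bigr).$$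
   Context: A team of $K$ agents acts in the fixed order $1,\dots,K$. Agent $k$ has a finite action set $\mathcal A_k$, observes the prefix $a_{<k}=(a_1,\dots,a_{k-1})$, and samples $a_k\sim\pi_k(\cdot\mid a_{<k})$. Write $a=(a_1,\dots,a_K)$, $a_{\le k}=(a_{<k},a_k)$, $a_{>k}=(a_{k+1},\dots,a_K)$. The joint policy factorizes autoregressively, $\pi(a)=\prod_k\pi_k(a_k\mid a_{<k})$. The conditional expectation $\mathbb E_\pi[\cdot\mid a_{\le k}]$ is over $a_{>k}\sim\prod_{j>k}\pi_j(\cdot\mid a_{<j})$ with $a_{\le k}$ fixed, and $\mathbb E_\pi[\cdot\mid a_{<k}]$ is over $(a_k,a_{>k})\sim\prod_{j\ge k}\pi_j(\cdot\mid a_{<j})$ with $a_{<k}$ fixed. An exogenous context on which everything may depend is fixed and suppressed. *)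

(* Defs.v *)
From HB Require Import structures.
From mathcomp Require Import all_boot all_order all_algebra.
From mathcomp Require Import reals.

Set Implicit Arguments.
Unset Strict Implicit.
Unset Printing Implicit Defensive.

Import Order.TTheory GRing.Theory Num.Theory.
Local Open Scope ring_scope.

(* Agents are numbered from 0: k : 'I_K stands for agent k + 1. *)

Definition joint (K : nat) (A : 'I_K -> finType) : finType :=
  {dffun forall j : 'I_K, A j}.

(* Actions of the first m agents. For k : 'I_K, the prefix a_{<k} lives in
   act_prefix A k and the prefix a_{<=k} lives in act_prefix A k.+1. *)
Definition act_prefix (K : nat) (A : 'I_K -> finType) (m : nat) : finType :=
  {dffun forall j : {j : 'I_K | (j < m)%N}, A (val j)}.

Definition restr (K : nat) (A : 'I_K -> finType) (m : nat) (a : joint A) :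
    act_prefix A m :=
  [ffun j : {j : 'I_K | (j < m)%N} => a (val j)].

(* The two components a_{<k} and a_k of a_{<=k} = (a_{<k}, a_k). *)
Definition before (K : nat) (A : 'I_K -> finType) (k : 'I_K)
    (q : act_prefix A k.+1) : act_prefix A k :=
  [ffun j : {j : 'I_K | (j < k)%N} => q (exist _ (val j) (leqW (valP j)))].

Definition own (K : nat) (A : 'I_K -> finType) (k : 'I_K)
    (q : act_prefix A k.+1) : A k :=
  q (exist _ k (ltnSn k)).

Record policy (R : realType) (K : nat) (A : 'I_K -> finType) := Policy {
  prob :> forall k : 'I_K, act_prefix A k -> A k -> R;
  prob_ge0 : forall (k : 'I_K) (p : act_prefix A k) (x : A k), 0 <= prob p x;
  prob_sum1 : forall (k : 'I_K) (p : act_prefix A k), \sum_(x : A k) prob p x = 1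
}.

(* E_pi[g(a) | p]: the first m actions are fixed to p and the remaining ones
   are drawn from the product of the policies of the agents of index >= m. The
   continuations of p are enumerated as the joint actions that extend p, so
   that the value is meaningful even if p has probability zero. *)
Definition condE (R : realType) (K : nat) (A : 'I_K -> finType)
    (pi : policy R A) (m : nat) (p : act_prefix A m) (g : joint A -> R) : R :=
  \sum_(a : joint A | restr m a == p)
    (\prod_(j < K | (m <= j)%N) pi j (restr j a) (a j)) * g a.

Definition ownE (R : realType) (K : nat) (A : 'I_K -> finType)
    (pi : policy R A) (k : 'I_K) (p : act_prefix A k) (h : A k -> R) : R :=
  \sum_(x : A k) pi k p x * h x.

Definition fhat (R : realType) (K : nat) (A : 'I_K -> finType)
    (phi : forall j : 'I_K, A j -> R) (a : joint A) : R :=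
  \sum_(j < K) phi j (a j).

Definition advLS (R : realType) (K : nat) (A : 'I_K -> finType)
    (pi : policy R A) (phi : forall j : 'I_K, A j -> R) (k : 'I_K)
    (q : act_prefix A k.+1) : R :=
  condE pi q (fhat phi) - condE pi (before q) (fhat phi).

(* Main.v *)
Require Import Defs.
From mathcomp Require Import all_boot all_order all_algebra.
From mathcomp Require Import reals.
Import Order.TTheory GRing.Theory Num.Theory.
Local Open Scope ring_scope.

(** The conditional expectation is linear, returns the value of a function
determined by the prefix (the continuation probabilities sum to 1), and
satisfies the one-step tower rule over the next action. So in the difference
the terms with j < k cancel and the term j = k is the local advantage. *)

Lemma extend_subproof {K : nat} {k j : 'I_K} :
  (j < k.+1)%N -> j != k -> (j < k)%N.
Proof. by rewrite ltnS leq_eqVlt => /predU1P[/val_inj -> /eqP|]. Qed.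

(** Inverse of [q] ↦ ([before q], [own q]). The type of an action depends on its agent, so [x] is
    transported along [j = k]. *)
Definition extend {K : nat} {A : 'I_K -> finType} {k : 'I_K}
    (p : act_prefix A k) (x : A k) : act_prefix A k.+1 :=
  [ffun j : {j : 'I_K | (j < k.+1)%N} =>
    match eqVneq (val j) k with
    | EqNotNeq e => ecast i (A i) (esym e) x
    | NeqNotEq ne => p (exist _ (val j) (extend_subproof (valP j) ne))
    end].

Lemma own_extend {K : nat} {A : 'I_K -> finType} {k : 'I_K}
  (p : act_prefix A k) (x : A k) : own (extend p x) = x.
Proof.
rewrite /own ffunE; case: eqVneq => /= [e|ne]; last by case/eqP: (ne).
(* Equality proofs between ordinals are unique, so the cast along [e : k = k] is trivial. *)
by rewrite (eq_irrelevance e erefl).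
Qed.

Lemma act_prefix_irr {K : nat} {A : 'I_K -> finType} {m : nat}
    (p : act_prefix A m) (j : 'I_K) (h h' : (j < m)%N) :
  p (exist _ j h) = p (exist _ j h').
Proof. by rewrite (bool_irrelevance h h'). Qed.

Lemma before_extend {K : nat} {A : 'I_K -> finType} {k : 'I_K}
  (p : act_prefix A k) (x : A k) : before (extend p x) = p.
Proof.
apply/ffunP => -[j jk]; rewrite !ffunE; case: eqVneq => /= [e|ne].
  by exfalso; move: jk; rewrite e ltnn.
exact: act_prefix_irr.
Qed.

Lemma extend_before_own {K : nat} {A : 'I_K -> finType} {k : 'I_K}
  (q : act_prefix A k.+1) : extend (before q) (own q) = q.
Proof.
apply/ffunP => -[j jk]; rewrite ffunE; case: eqVneq => /= [e|ne].
  by subst j; apply: act_prefix_irr.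
by rewrite ffunE; apply: act_prefix_irr.
Qed.

Lemma before_restr {K : nat} {A : 'I_K -> finType} (k : 'I_K) (a : joint A) :
  before (restr k.+1 a) = restr k a.
Proof. by apply/ffunP => j; rewrite !ffunE. Qed.

Lemma own_restr {K : nat} {A : 'I_K -> finType} (k : 'I_K) (a : joint A) :
  own (restr k.+1 a) = a k.
Proof. by rewrite /own ffunE. Qed.

(** Group the continuations of [p] by the action of agent [k]. Those choosing [x] are exactly the
    continuations of [extend p x], and on them the factor of index [k] is the constant [pi k p x],
    which leaves the factors of index above [k]. *)
Lemma condE_tower {R : realType} {K : nat} {A : 'I_K -> finType}
    (pi : policy R A) (k : 'I_K) (p : act_prefix A k) (g : joint A -> R) :
  condE pi p g = ownE pi p (fun x => condE pi (extend p x) g).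
Proof.
rewrite /condE /ownE (partition_big (fun a : joint A => a k) xpredT) //=.
apply: eq_bigr => x _; rewrite mulr_sumr; apply: eq_big => [a|a].
  apply/andP/eqP => [[/eqP <- /eqP <-]|ea].
    by rewrite -before_restr -own_restr extend_before_own.
  by rewrite -before_restr -own_restr ea before_extend own_extend !eqxx.
case/andP => /eqP ra /eqP ax; rewrite mulrA; congr (_ * _).
rewrite (bigD1 k) //= ra ax; congr (_ * _); apply: eq_bigl => j.
by rewrite [(k < j)%N]ltn_neqAle andbC eq_sym.
Qed.

(** Induction on the number [K - m] of agents still to act: the tower rule peels off agent [m],
    whose probabilities sum to 1. *)
Lemma condE_const {R : realType} {K : nat} {A : 'I_K -> finType}
    (pi : policy R A) (m : nat) (p : act_prefix A m) (c : R) :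
  condE pi p (fun=> c) = c.
Proof.
elim: {m}(K - m)%N {-2}m (erefl (K - m)%N) p => [|n IHn] m.
  move/eqP; rewrite subn_eq0 => Km p.
  (* For [K <= m] the prefix fixes every action: [a] is its only continuation, with an empty product
     as weight. *)
  pose a : joint A := [ffun j : 'I_K => p (exist _ j (leq_trans (ltn_ord j) Km))].
  rewrite /condE (big_pred1 a) => [|b].
    by rewrite big_pred0 ?mul1r // => j; rewrite leqNgt (leq_trans (ltn_ord j)).
  apply/eqP/eqP => [rb|->]; apply/ffunP; first by move=> j; rewrite ffunE -rb ffunE.
  by case=> j jm; rewrite !ffunE; apply: act_prefix_irr.
move=> Kmn; have mK : (m < K)%N by rewrite -subn_gt0 Kmn.
move=> p; have /= -> := @condE_tower _ _ _ pi (Ordinal mK) p (fun=> c).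
rewrite /ownE.
under eq_bigr do rewrite IHn ?subnS ?Kmn //.
by rewrite -mulr_suml prob_sum1 mul1r.
Qed.

Lemma condE_determined {R : realType} {K : nat} {A : 'I_K -> finType}
    (pi : policy R A) (m : nat) (p : act_prefix A m) (g : joint A -> R) (c : R) :
  (forall a, restr m a = p -> g a = c) -> condE pi p g = c.
Proof.
by move=> gc; rewrite -[RHS](condE_const pi m p); apply: eq_bigr => a /eqP /gc ->.
Qed.

Lemma condE_sum {R : realType} {K : nat} {A : 'I_K -> finType}
    (pi : policy R A) (m : nat) (p : act_prefix A m)
    (I : finType) (g : I -> joint A -> R) :
  condE pi p (fun a => \sum_i g i a) = \sum_i condE pi p (g i).
Proof. by rewrite exchange_big; apply: eq_bigr => a _; rewrite mulr_sumr. Qed.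

Theorem mainTheorem4 (R : realType) (K : nat) (A : 'I_K -> finType)
    (pi : policy R A) (phi : forall j : 'I_K, A j -> R)
    (k : 'I_K) (q : act_prefix A k.+1) :
  advLS pi phi q =
    (phi k (own q) - ownE pi (before q) (phi k))
    + \sum_(j < K | (k < j)%N)
        (condE pi q (fun a => phi j (a j))
         - condE pi (before q) (fun a => phi j (a j))).
Proof.
rewrite /advLS /fhat !condE_sum -sumrB (bigD1 k) //=; congr (_ + _).
  congr (_ - _).
    by apply: condE_determined => a <-; rewrite own_restr.
  (* [before q] does not determine the action of agent [k], but each [extend (before q) x] does. *)
  rewrite condE_tower; apply: eq_bigr => x _; congr (_ * _).
  by apply: condE_determined => a ra; rewrite -own_restr ra own_extend.
(* Among the indices other than [k], keep those above [k] and show that those below contribute 0. *)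
rewrite (bigID (fun j : 'I_K => (k < j)%N)) /= [X in _ + X]big1 => [|j].
  rewrite addr0; apply: eq_bigl => j.
  by apply: andb_idl => kj; rewrite neq_ltn kj orbT.
rewrite -leqNgt => /andP[jk kj]; have {jk kj} jk := extend_subproof kj jk.
have E (a : joint A) : a j = restr k a (exist _ j jk) by rewrite ffunE.
apply/eqP; rewrite subr_eq0; apply/eqP.
(* The action of an agent [j < k] is already recorded in [before q], so both expectations equal this
   value. *)
transitivity (phi j (before q (exist _ j jk))).
  by apply: condE_determined => a <-; rewrite before_restr E.
by apply/esym/condE_determined => a <-; rewrite E.
Qed.
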